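(* Let $n\ge1$ and let $\mathbb{Z}/2\ltimes(\mathbb{Z}/n\oplus\mathbb{Z}/n)$ be the semidirect product where the action of (the generator of) $\mathbb{Z}/2$ on $\mathbb{Z}/n\oplus\mathbb{Z}/n$ is defined by the matrix $$A=\begin{pmatrix}a&b\\ c&-a\end{pmatrix}$$ with entries in $\mathbb{Z}/n$ and $\det(A)=-1$. Let $k$ be a field such that $k^\times/(k^\times)^{2n}=0$. Then $$\operatorname{Opext}_{\lhd}(k\mathbb{Z}/2,k^{\mathbb{Z}/n\oplus\mathbb{Z}/n})\cong\frac{\operatorname{Ker}(A-I)}{\operatorname{Im}(A+I)}\oplus\mu_n(k),$$ where $\mu_n(k)$ is the group of $n$-th roots of unity in $k$, and $A$ on the right-hand side denotes the operator $\psi\mapsto\psi\circ A$ induced on the group $\operatorname{Hom}(\mathbb{Z}/n\oplus\mathbb{Z}/n,k^\times)$ (written additively).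
   Context: Let a finite group $F$ act on the right on a finite group $N$ by automorphisms via $\lhd:N\times F\to N$ (here $F=\mathbb{Z}/2$ and $N=\mathbb{Z}/n\oplus\mathbb{Z}/n$, the generator acting by $v\mapsto Av$). Define $\operatorname{Opext}_\lhd(kF,k^N)$ as follows. Consider pairs $(\sigma,\tau)$ of maps $\sigma:N\times F\times F\to k^\times$, $\tau:N\times N\times F\to k^\times$ that are normalized ($\sigma(s;x,y)=1$ if $x=e$ or $y=e$; $\tau(s,t;x)=1$ if $s=e$ or $t=e$) and satisfy, for all $s,t,r\in N$, $x,y,z\in F$ (groups written multiplicatively), $$\sigma(s\lhd x;y,z)\sigma(s;x,yz)=\sigma(s;x,y)\sigma(s;xy,z),\qquad \tau(st,r;x)\tau(s,t;x)=\tau(s,tr;x)\tau(t,r;x),$$ $$\sigma(st;x,y)\tau(s,t;xy)=\sigma(s;x,y)\sigma(t;x,y)\tau(s,t;x)\tau(s\lhd x,t\lhd x;y).$$ Such a pair defines a Hopf algebra $k^N\#_{\sigma,\tau}kF$ with basis $\{e_s\#x\}$, product $(e_s\#x)(e_t\#y)=\delta_{s\lhd x,t}\sigma(s;x,y)e_s\#xy$, coproduct $\Delta(e_s\#x)=\sum_{ab=s}\tau(a,b;x)e_a\#x\otimes e_b\#x$, and an extension $k\to k^N\to k^N\#_{\sigma,\tau}kF\to kF\to k$ with maps $e_s\mapsto e_s\#e$ and $e_s\#x\mapsto\delta_{s,e}x$. Two extensions are equivalent if there is a Hopf algebra homomorphism between the middle terms commuting with the maps from $k^N$ and to $kF$.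 $\operatorname{Opext}_{\lhd}(kF,k^N)$ is the abelian group of equivalence classes, with the Baer product (induced by pointwise multiplication of pairs $(\sigma,\tau)$). *)

(* Defs.v *)
From HB Require Import structures.
From mathcomp Require Import all_boot all_order all_fingroup all_algebra.
From mathcomp Require Import boolp.

Set Implicit Arguments.
Unset Strict Implicit.
Unset Printing Implicit Defensive.

Import GroupScope GRing.Theory.
Local Open Scope ring_scope.
Local Open Scope quotient_scope.

Definition zmod_iso (U V : zmodType) : Prop :=
  exists f : {additive U -> V}, bijective f.

(* k^x is a zmodType, hence its group law is WRITTEN ADDITIVELY:
   val (u + v) = val u * val v,  val 0 = 1,  val (u *+ n) = val u ^+ n. *)
Section Units.
Variable k : fieldType.

Record units := Units { uval : k; _ : uval != 0 }.

HB.instance Definition _ := [isSub for uval].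
HB.instance Definition _ := [Choice of units by <:].

Fact units_one_subproof : (1 : k) != 0. Proof. exact: oner_neq0. Qed.
Fact units_mul_subproof (u v : units) : val u * val v != 0.
Proof. by rewrite mulf_neq0 ?(valP u) ?(valP v). Qed.
Fact units_inv_subproof (u : units) : (val u)^-1 != 0.
Proof. by rewrite invr_neq0 ?(valP u). Qed.

Definition units_one := Units units_one_subproof.
Definition units_mul u v := Units (units_mul_subproof u v).
Definition units_inv u := Units (units_inv_subproof u).

Fact units_mulA : associative units_mul.
Proof. by move=> u v w; apply/val_inj/mulrA. Qed.
Fact units_mulC : commutative units_mul.
Proof. by move=> u v; apply/val_inj/mulrC. Qed.
Fact units_mul1 : left_id units_one units_mul.
Proof. by move=> u; apply/val_inj/mul1r. Qed.
Fact units_mulV : left_inverse units_one units_inv units_mul.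
Proof. by move=> u; apply/val_inj/mulVf/(valP u). Qed.

HB.instance Definition _ :=
  GRing.isZmodule.Build units units_mulA units_mulC units_mul1 units_mulV.

Lemma val_units0 : val (0 : units) = 1. Proof. by []. Qed.
Lemma val_unitsD (u v : units) : val (u + v) = val u * val v.
Proof. by []. Qed.
Lemma val_unitsN (u : units) : val (- u) = (val u)^-1. Proof. by []. Qed.
Lemma val_unitsMn (u : units) n : val (u *+ n) = val u ^+ n.
Proof. by elim: n => // n IHn; rewrite mulrS exprS -IHn. Qed.
Lemma units_neq0 (u : units) : val u != 0. Proof. exact: (valP u). Qed.

End Units.

Section Mu.
Variables (n : nat) (k : fieldType).

Definition mu_pred : pred (units k) := [pred u | val u ^+ n == 1].

Fact mu_zmod_closed : zmod_closed mu_pred.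
Proof.
split=> [|u v]; rewrite !inE ?expr1n // => /eqP un /eqP vn.
by rewrite val_unitsD val_unitsN exprMn exprVn un vn invr1 mulr1.
Qed.
HB.instance Definition _ :=
  GRing.isZmodClosed.Build (units k) mu_pred mu_zmod_closed.

Record mu := Mu { mu_val : units k; _ : mu_val \in mu_pred }.
HB.instance Definition _ := [isSub for mu_val].
HB.instance Definition _ := [Choice of mu by <:].
HB.instance Definition _ := [SubChoice_isSubZmodule of mu by <:].
End Mu.

Section Hom.
Variables (N : finGroupType) (k : fieldType).

Definition hom_pred : pred {ffun N -> units k} :=
  [pred psi : {ffun N -> units k} | [forall s, forall t, psi (s * t)%g == psi s + psi t]].

Lemma hom_predP (psi : {ffun N -> units k}) :
  reflect (forall s t, psi (s * t)%g = psi s + psi t) (psi \in hom_pred).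
Proof.
apply: (iffP forallP) => [h s t|h s]; first by have /forallP/(_ t)/eqP := h s.
by apply/forallP=> t; rewrite h.
Qed.

Fact hom_zmod_closed : zmod_closed hom_pred.
Proof.
split=> [|u v /hom_predP hu /hom_predP hv]; apply/hom_predP=> s t.
  by rewrite !ffunE addr0.
by rewrite !ffunE hu hv opprD addrACA.
Qed.
HB.instance Definition _ :=
  GRing.isZmodClosed.Build {ffun N -> units k} hom_pred hom_zmod_closed.

Record homU := HomU { hom_val : {ffun N -> units k}; _ : hom_val \in hom_pred }.
HB.instance Definition _ := [isSub for hom_val].
HB.instance Definition _ := [Choice of homU by <:].
HB.instance Definition _ := [SubChoice_isSubZmodule of homU by <:].

Lemma homUM (psi : homU) s t :
  val psi (s * t)%g = val psi s + val psi t.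
Proof. exact: (hom_predP _ (valP psi)). Qed.
End Hom.

Section KerIm.
Variable V : zmodType.
Implicit Types f g : {additive V -> V}.

Definition ker_pred f : pred V := [pred x | f x == 0].

Fact ker_zmod_closed f : zmod_closed (ker_pred f).
Proof.
split=> [|x y]; rewrite !inE ?raddf0 // => /eqP fx /eqP fy.
by rewrite raddfB fx fy subrr.
Qed.
HB.instance Definition _ f :=
  GRing.isZmodClosed.Build V (ker_pred f) (ker_zmod_closed f).

Record ker f := Ker { ker_val : V; _ : ker_val \in ker_pred f }.
HB.instance Definition _ f := [isSub for @ker_val f].
HB.instance Definition _ f := [Choice of ker f by <:].
HB.instance Definition _ f := [SubChoice_isSubZmodule of ker f by <:].

Definition im_pred f g : pred (ker f) := [pred x | `[< exists y, val x = g y >]].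
Arguments im_pred : clear implicits.

Fact im_zmod_closed f g : zmod_closed (im_pred f g).
Proof.
split=> [|x y /asboolP[x' ex] /asboolP[y' ey]]; apply/asboolP.
  by exists 0; rewrite !raddf0.
by exists (x' - y'); rewrite raddfB -ex -ey.
Qed.
HB.instance Definition _ f g :=
  GRing.isZmodClosed.Build (ker f) (im_pred f g) (im_zmod_closed f g).

(* Ker f / (Ker f :&: Im g); it is Ker f / Im g when f \o g = 0. *)
Definition ker_mod_im f g : zmodType := Quotient.quot (GRing.ZmodClosed.clone (ker f) (im_pred f g) _).
End KerIm.

(* {ffun I -> k^o} is the free k-module with basis (bas i)_(i : I); lext g is the
   linear extension of a map g given on the basis.  The free module on I * J
   stands for the tensor product of the free modules on I and J, with
   bas (i, j) for bas i (x) bas j. *)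
Section FreeModule.
Variable k : fieldType.
Local Notation free I := {ffun I -> k^o}.

Definition bas (I : finType) (i : I) : free I := [ffun j => (j == i)%:R].

Definition lext (I : finType) (V : lmodType k) (g : I -> V) (u : free I) : V :=
  \sum_i u i *: g i.

Definition tens (I J : finType) (u : free I) (v : free J) : free (I * J)%type :=
  [ffun ij => u ij.1 * v ij.2].

Definition tens_map (I J : finType) (f : free I -> free J) :
    free (I * I)%type -> free (J * J)%type :=
  lext (fun ij => tens (f (bas ij.1)) (f (bas ij.2))).

Lemma lextE (I : finType) (V : lmodType k) (g : I -> V) i : lext g (bas i) = g i.
Proof.
rewrite /lext (bigD1 i) //= ffunE eqxx scale1r big1 ?addr0 // => j /negPf ne.
by rewrite ffunE ne scale0r.
Qed.

Lemma lext_is_linear (I : finType) (V : lmodType k) (g : I -> V) : linear (lext g).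
Proof.
move=> a u v; rewrite /lext scaler_sumr -big_split /=; apply: eq_bigr => i _.
by rewrite !ffunE scalerDl scalerA.
Qed.
HB.instance Definition _ (I : finType) (V : lmodType k) (g : I -> V) :=
  GRing.isLinear.Build k (free I) V *:%R (lext g) (lext_is_linear g).

Lemma free_sum (I : finType) (u : free I) : u = lext (@bas I) u.
Proof.
apply/ffunP => i; rewrite /lext sum_ffunE (bigD1 i) //= big1 => [|j /negPf ne].
  by rewrite !ffunE eqxx addr0 [_ *: _]mulr1.
by rewrite !ffunE eq_sym ne [_ *: _]mulr0.
Qed.

Lemma eq_lin_bas (I : finType) (V : lmodType k) (f g : {linear free I -> V}) :
  (forall i, f (bas i) = g (bas i)) -> f =1 g.
Proof.
move=> h u; rewrite (free_sum u) /lext !linear_sum.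
by apply: eq_bigr => i _; rewrite !linearZ /= h.
Qed.
End FreeModule.

Section Opext.
Variables (F N : finGroupType) (k : fieldType).
Variable lhd : groupAction [set: F] [set: N].
Local Notation free I := {ffun I -> k^o}.

Definition cochains : Type :=
  ({ffun N * F * F -> units k} * {ffun N * N * F -> units k})%type.
HB.instance Definition _ := GRing.Zmodule.on cochains.

(* p = (sigma, tau).  The conditions take place in k^x, whose law is written
   additively. *)
Record is_cocycle_pair (p : cochains) : Prop := IsCocyclePair {
  sigma1r : forall s x, p.1 (s, x, 1%g) = 0;
  sigma1l : forall s y, p.1 (s, 1%g, y) = 0;
  tau1r : forall s x, p.2 (s, 1%g, x) = 0;
  tau1l : forall t x, p.2 (1%g, t, x) = 0;
  sigma_cocycle : forall s x y z,
    p.1 (lhd s x, y, z) + p.1 (s, x, y * z)%g =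
    p.1 (s, x, y) + p.1 (s, x * y, z)%g;
  tau_cocycle : forall s t r x,
    p.2 (s * t, r, x)%g + p.2 (s, t, x) =
    p.2 (s, t * r, x)%g + p.2 (t, r, x);
  sigma_tau_compat : forall s t x y,
    p.1 (s * t, x, y)%g + p.2 (s, t, x * y)%g =
    p.1 (s, x, y) + p.1 (t, x, y) + p.2 (s, t, x) + p.2 (lhd s x, lhd t x, y)
}.

(* The Hopf algebra k^N #_(sigma,tau) kF on the basis e_s # x = bas (s, x), and
   the maps of the extension k -> k^N -> k^N # kF -> kF -> k.  The unit is
   sum_s e_s # 1 and the counit is e_s # x |-> delta_(s,1). *)
Section SmashProduct.
Variable p : cochains.

Definition smash_mul_bas (i j : N * F) : free (N * F)%type :=
  if lhd i.1 i.2 == j.1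
  then val (p.1 (i.1, i.2, j.2)) *: bas k (i.1, i.2 * j.2)%g else 0.

Definition smash_mul (u v : free (N * F)%type) : free (N * F)%type :=
  lext (fun i => lext (smash_mul_bas i) v) u.

Definition smash_one : free (N * F)%type := \sum_s bas k (s, 1%g).

Definition smash_comul_bas (i : N * F) : free ((N * F) * (N * F))%type :=
  \sum_a \sum_(b | (a * b)%g == i.1)
    val (p.2 (a, b, i.2)) *: bas k ((a, i.2), (b, i.2)).

Definition smash_comul : free (N * F)%type -> free ((N * F) * (N * F))%type :=
  lext smash_comul_bas.

Definition smash_counit : free (N * F)%type -> k^o :=
  lext (fun i => (i.1 == 1%g)%:R).
End SmashProduct.

Definition smash_inj : free N -> free (N * F)%type :=
  lext (fun s => bas k (s, 1%g)).

Definition smash_proj : free (N * F)%type -> free F :=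
  lext (fun i => if i.1 == 1%g then bas k i.2 else 0).

(* Morphisms of bialgebras; between Hopf algebras these are the Hopf algebra
   morphisms, since they automatically commute with the antipodes. *)
Record is_hopf_morphism (p q : cochains)
    (f : {linear free (N * F)%type -> free (N * F)%type}) : Prop :=
  IsHopfMorphism {
    hopf_mul : forall u v, f (smash_mul p u v) = smash_mul q (f u) (f v);
    hopf_one : f smash_one = smash_one;
    hopf_comul : forall u, smash_comul q (f u) = tens_map f (smash_comul p u);
    hopf_counit : forall u, smash_counit (f u) = smash_counit u
  }.

Definition ext_equiv (p q : cochains) : Prop :=
  exists f : {linear free (N * F)%type -> free (N * F)%type},
    [/\ is_hopf_morphism p q f,
        forall phi, f (smash_inj phi) = smash_inj phi
      & forall u, smash_proj (f u) = smash_proj u].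

Definition cocycle_pair_pred : pred cochains :=
  [pred p | `[< is_cocycle_pair p >]].

Fact cocycle_pair_zmod_closed : zmod_closed cocycle_pair_pred.
Proof.
have acB (a b c d : units k) : a - b + (c - d) = (a + c) - (b + d).
  by rewrite opprD addrACA.
split=> [|p q /asboolP[p1 p2 p3 p4 p5 p6 p7] /asboolP[q1 q2 q3 q4 q5 q6 q7]];
    apply/asboolP; split=> *; rewrite !ffunE ?addr0 //.
- by rewrite p1 q1 subrr.
- by rewrite p2 q2 subrr.
- by rewrite p3 q3 subrr.
- by rewrite p4 q4 subrr.
- by rewrite !acB p5 q5.
- by rewrite !acB p6 q6.
- by rewrite !acB p7 q7.
Qed.
HB.instance Definition _ :=
  GRing.isZmodClosed.Build cochains cocycle_pair_pred cocycle_pair_zmod_closed.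

Record cocycle_pair := CocyclePair {
  cp_val : cochains; _ : cp_val \in cocycle_pair_pred }.
HB.instance Definition _ := [isSub for cp_val].
HB.instance Definition _ := [Choice of cocycle_pair by <:].
HB.instance Definition _ := [SubChoice_isSubZmodule of cocycle_pair by <:].

Lemma cocycle_pairP (p : cocycle_pair) : is_cocycle_pair (val p).
Proof. exact/asboolP/(valP p). Qed.

Record cobounding (p q : cochains) (r : {ffun N * F -> units k}) : Prop :=
  Cobounding {
    cob1r : forall s, r (s, 1%g) = 0;
    cob1l : forall x, r (1%g, x) = 0;
    cob_sigma : forall s x y,
      p.1 (s, x, y) + r (s, x * y)%g =
      q.1 (s, x, y) + (r (s, x) + r (lhd s x, y));
    cob_tau : forall a b x,
      q.2 (a, b, x) + r (a * b, x)%g = p.2 (a, b, x) + (r (a, x) + r (b, x))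
  }.

Lemma lext_coef (I J : finType) (g : I -> free J) (u : free I) j :
  lext g u j = \sum_i u i * g i j.
Proof. by rewrite /lext sum_ffunE; apply: eq_bigr => i _; rewrite ffunE. Qed.

Lemma smash_mulE p i j : smash_mul p (bas k i) (bas k j) = smash_mul_bas p i j.
Proof. by rewrite /smash_mul !lextE. Qed.

Lemma smash_mul_sum p (u v : free (N * F)%type) :
  smash_mul p u v = \sum_i \sum_j (u i * v j) *: smash_mul_bas p i j.
Proof.
apply: eq_bigr => i _; rewrite /lext scaler_sumr.
by apply: eq_bigr => j _; rewrite scalerA.
Qed.

Lemma smash_mul_unitl p s (v : free (N * F)%type) i :
  is_cocycle_pair p ->
  smash_mul p (bas k (s, 1%g)) v i = (i.1 == s)%:R * v i.
Proof.
case: i => t y pP; rewrite /smash_mul lextE lext_coef (bigD1 (t, y)) //=.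
rewrite big1 ?addr0 => [|[t' y'] ne];
  rewrite /smash_mul_bas /= act1 sigma1l // scale1r mul1g.
  by rewrite eq_sym; case: eqP => [->|_]; rewrite ffunE ?eqxx ?mulr1 ?mul1r ?mulr0 ?mul0r.
case: eqP => [->|_]; rewrite ffunE ?mulr0 // eq_sym.
by rewrite (negPf ne) mulr0.
Qed.

Lemma smash_comul_coef p (u : free (N * F)%type) a b y z :
  smash_comul p u ((a, y), (b, z)) =
  (y == z)%:R * (u (a * b, y)%g * val (p.2 (a, b, y))).
Proof.
rewrite /smash_comul lext_coef (bigD1 (a * b, y)%g) //= [X in _ + X]big1 ?addr0.
  rewrite mulrCA; congr (_ * _); rewrite /smash_comul_bas /= sum_ffunE.
  rewrite (bigD1 a) //= [X in _ + X]big1 ?addr0 => [|c ne].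
    rewrite sum_ffunE (bigD1 b) //= big1 ?addr0 => [|c /andP[_ ne]].
      by rewrite !ffunE !xpair_eqE !eqxx /= eq_sym mulrC.
    by rewrite !ffunE !xpair_eqE [b == c]eq_sym (negPf ne) !andbF [_ *: _]mulr0.
  rewrite sum_ffunE big1 // => d _.
  by rewrite !ffunE !xpair_eqE [a == c]eq_sym (negPf ne) [_ *: _]mulr0.
move=> [s x] ne; rewrite /smash_comul_bas /= sum_ffunE big1 ?mulr0 // => c _.
rewrite sum_ffunE big1 // => d /eqP e; rewrite !ffunE !xpair_eqE.
suff -> : [&& (a == c) && (y == x), b == d & z == x] = false by rewrite [_ *: _]mulr0.
apply: contraNF ne => /andP[/andP[/eqP -> /eqP ->] /andP[/eqP -> _]].
by rewrite e.
Qed.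

Lemma smash_proj_coef (u : free (N * F)%type) x : smash_proj u x = u (1%g, x).
Proof.
rewrite /smash_proj lext_coef (bigD1 (1%g, x)) //= eqxx ffunE eqxx mulr1.
rewrite big1 ?addr0 // => -[s y]; rewrite xpair_eqE /=.
case: eqP => [_ /= ne|_ _]; rewrite ffunE ?mulr0 //.
by rewrite eq_sym (negPf ne) mulr0.
Qed.

Lemma tens_map_coef (f : free (N * F)%type -> free (N * F)%type) T i j :
  tens_map f T (i, j) = \sum_l T l * (f (bas k l.1) i * f (bas k l.2) j).
Proof.
by rewrite /tens_map lext_coef; apply: eq_bigr => l _; rewrite ffunE.
Qed.

Lemma smash_counit_coef (u : free (N * F)%type) :
  smash_counit u = \sum_x u (1%g, x).
Proof.
rewrite /smash_counit /lext (eq_bigr (fun i => if i.1 == 1%g then u i else 0)).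
  rewrite -big_mkcond /= (eq_bigl (fun i => (i.1 == 1%g) && true)); last first.
    by move=> i; rewrite andbT.
  rewrite (eq_bigr (fun i => u (i.1, i.2))); last by case.
  by rewrite -(pair_big_dep (pred1 1%g) (fun _ _ => true) (fun s x => u (s, x))) /= big_pred1_eq.
by move=> i _; case: eqP => _; rewrite ?[_ *: _]mulr1 ?[_ *: _]mulr0.
Qed.

Lemma ext_morphism_diag p q f :
  is_cocycle_pair p -> is_cocycle_pair q -> is_hopf_morphism p q f ->
  (forall phi, f (smash_inj phi) = smash_inj phi) ->
  (forall u, smash_proj (f u) = smash_proj u) ->
  forall i, f (bas k i) = f (bas k i) i *: bas k i.
Proof.
move=> pP qP fH fi fp.
have fe1 s : f (bas k (s, 1%g)) = bas k (s, 1%g).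
  by have := fi (bas k s); rewrite /smash_inj lextE.
have supp s x i : f (bas k (s, x)) i = (i.1 == s)%:R * f (bas k (s, x)) i.
  have e : smash_mul p (bas k (s, 1%g)) (bas k (s, x)) = bas k (s, x).
    apply/ffunP => j; rewrite smash_mul_unitl // !ffunE; case: j => t y.
    by rewrite xpair_eqE /=; case: (t == s); rewrite ?mul1r ?mul0r.
  by rewrite -{1}e (hopf_mul fH) fe1 smash_mul_unitl.
move=> [s x]; apply/ffunP => -[t y]; rewrite !ffunE xpair_eqE supp /=.
case: eqP => [->|_]; last by rewrite mul0r [_ *: _]mulr0.
rewrite mul1r; case: eqP => [->|/eqP ne]; first by rewrite [_ *: _]mulr1.
rewrite [_ *: _]mulr0.
have /(congr1 (fun T : free ((N * F) * (N * F))%type => T ((s, y), (1%g, y)))) :=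
  hopf_comul fH (bas k (s, x)).
rewrite smash_comul_coef eqxx mul1r mulg1 tau1r // mulr1 => ->.
rewrite tens_map_coef big1 // => -[[a z] [b w]] _ /=.
rewrite smash_comul_coef (supp a) (supp b) /= !ffunE xpair_eqE.
have [<-|ne1] := eqVneq s a; last by rewrite mul0r mul0r mulr0.
have [<-|ne2] := eqVneq 1%g b; last by rewrite mul0r !mulr0.
have [<-|nw] := eqVneq z w; last by rewrite !mul0r.
have [->|nz] := eqVneq z x; last by rewrite andbF !mul0r mulr0 mul0r.
rewrite -[f (bas k (1%g, x)) _]smash_proj_coef fp smash_proj_coef ffunE.
by rewrite xpair_eqE eqxx /= (negPf ne) !mulr0.
Qed.

Lemma ext_equivP p q :
  is_cocycle_pair p -> is_cocycle_pair q ->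
  ext_equiv p q <-> exists r, cobounding p q r.
Proof.
move=> pP qP; split=> [[f [fH fi fp]]|[r [r1 r2 r3 r4]]].
  have fd := ext_morphism_diag pP qP fH fi fp.
  pose c i : k := f (bas k i) i.
  have fe1 s : c (s, 1%g) = 1.
    have := fi (bas k s); rewrite /smash_inj lextE /c => ->.
    by rewrite ffunE eqxx.
  have cM s x y : val (p.1 (s, x, y)) * c (s, x * y)%g =
      val (q.1 (s, x, y)) * (c (s, x) * c (lhd s x, y)).
    have := hopf_mul fH (bas k (s, x)) (bas k (lhd s x, y)).
    rewrite (fd (s, x)) (fd (lhd s x, y)) smash_mulE /smash_mul_bas /= eqxx.
    rewrite linearZ /= (fd (s, x * y)%g) -/(c _) -/(c _) -/(c _).
    have mZZ a b i j : smash_mul q (a *: bas k i) (b *: bas k j) =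
        (a * b) *: smash_mul_bas q i j.
      by rewrite /smash_mul /= linearZ /= lextE linearZ /= lextE scalerA.
    rewrite mZZ /smash_mul_bas /= eqxx !scalerA => /ffunP/(_ (s, x * y)%g).
    by rewrite !ffunE eqxx /= ![_ *: _]mulr1 => ->; rewrite mulrC.
  have c_neq0 i : c i != 0.
    case: i => s x; apply/eqP => c0; have /eqP := cM s x (x^-1)%g.
    rewrite mulgV fe1 c0 mul0r mulr0 mulr1.
    by rewrite (negPf (units_neq0 _)).
  exists [ffun i => @Units k (c i) (c_neq0 i)]; split=> [s|x|s x y|a b x]; rewrite !ffunE;
    apply/val_inj => //=.
  - by rewrite /c -smash_proj_coef fp smash_proj_coef ffunE eqxx.
  - exact: cM.
  have /(congr1 (fun T : free ((N * F) * (N * F))%type => T ((a, x), (b, x)))) :=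
    hopf_comul fH (bas k (a * b, x)%g).
  rewrite smash_comul_coef eqxx mul1r -/(c _) mulrC => ->.
  rewrite tens_map_coef (bigD1 ((a, x), (b, x))) //= big1 ?addr0.
    by rewrite smash_comul_coef ffunE !eqxx !mul1r.
  move=> [i j]; rewrite xpair_eqE /= => ne; rewrite (fd i) (fd j) !ffunE.
  move: ne; rewrite eq_sym [j == _]eq_sym.
  by case: eqP => _ //=; [case: eqP => // _ _|move=> _];
    rewrite ?[_ *: 0]mulr0 ?[_ *: (0 : k^o)]mulr0 ?mul0r ?mulr0.
pose g i : free (N * F)%type := val (r i) *: bas k i.
have gE i : lext g (bas k i) = val (r i) *: bas k i by rewrite lextE.
have gc u i : lext g u i = val (r i) * u i.
  rewrite lext_coef (bigD1 i) //= big1 ?addr0 => [|j ne].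
    by rewrite !ffunE eqxx [_ *: _]mulr1 mulrC.
  by rewrite !ffunE eq_sym (negPf ne) [_ *: _]mulr0 mulr0.
exists (lext g); split=> [|phi|u]; first split=> [u v||u|u].
- rewrite !smash_mul_sum linear_sum; apply: eq_bigr => i _ /=.
  rewrite linear_sum; apply: eq_bigr => j _ /=; rewrite linearZ /= !gc.
  have -> : lext g (smash_mul_bas p i j) = (val (r i) * val (r j)) *: smash_mul_bas q i j.
    case: i j => [s x] [t y]; rewrite /smash_mul_bas /=.
    case: eqP => [<-|_]; last by rewrite linear0 scaler0.
    rewrite linearZ /= gE !scalerA; congr (_ *: _).
    by have /(congr1 val) := r3 s x y; rewrite !val_unitsD => ->; rewrite mulrC.
  by rewrite scalerA [in RHS]mulrACA [in RHS]mulrC.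
- rewrite /smash_one linear_sum; apply: eq_bigr => s _ /=.
  by rewrite gE r1 scale1r.
- apply/ffunP => -[[a y] [b z]]; rewrite smash_comul_coef gc.
  rewrite tens_map_coef (bigD1 ((a, y), (b, z))) //= big1 ?addr0.
    rewrite smash_comul_coef !gE !ffunE !eqxx.
    have [<-|_] := eqVneq y z; last by rewrite !mul0r.
    have /(congr1 val) := r4 a b y; rewrite !val_unitsD /= => e.
    rewrite !mul1r ![_ *: 1]mulr1 -[RHS]mulrA -e.
    by rewrite -[LHS]mulrA mulrC -[LHS]mulrA.
  move=> [i j]; rewrite xpair_eqE /= => ne; rewrite !gE !ffunE.
  move: ne; rewrite eq_sym [j == _]eq_sym.
  by case: eqP => _ //=; [case: eqP => // _ _|move=> _];
    rewrite ?[_ *: 0]mulr0 ?[_ *: (0 : k^o)]mulr0 ?mul0r ?mulr0.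
- rewrite !smash_counit_coef; apply: eq_bigr => x _.
  by rewrite gc r2 mul1r.
- rewrite /smash_inj /lext linear_sum; apply: eq_bigr => s _ /=.
  by rewrite linearZ /= -/(lext g _) gE r1 scale1r.
apply/ffunP => x; rewrite !smash_proj_coef gc r2.
by rewrite mul1r.
Qed.

Lemma cobounding0 p : cobounding p p 0.
Proof. by split=> *; rewrite !ffunE ?addr0. Qed.

Lemma coboundingN p q r : cobounding p q r -> cobounding q p (- r).
Proof.
have swap (a b c d : units k) : a + b = c + d -> c - b = a - d.
  by move=> e; apply/eqP; rewrite subr_eq addrAC eq_sym subr_eq e.
case=> r1 r2 r3 r4; split=> [s|x|s x y|a b x]; rewrite !ffunE.
- by rewrite r1 oppr0.
- by rewrite r2 oppr0.
- by rewrite -opprD; exact: swap.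
by rewrite -opprD; exact: swap.
Qed.

Lemma coboundingD p q p' q' r r' :
  cobounding p q r -> cobounding p' q' r' -> cobounding (p + p') (q + q') (r + r').
Proof.
case=> r1 r2 r3 r4 [s1 s2 s3 s4].
split=> [s|x|s x y|a b x]; rewrite !ffunE.
- by rewrite r1 s1 addr0.
- by rewrite r2 s2 addr0.
- by rewrite addrACA r3 s3 addrACA; congr (_ + _); rewrite addrACA.
by rewrite addrACA r4 s4 addrACA; congr (_ + _); rewrite addrACA.
Qed.

Lemma cobounding_trans p q t r r' :
  cobounding p q r -> cobounding q t r' -> cobounding p t (r + r').
Proof.
move=> /coboundingD h /h /coboundingD /(_ (cobounding0 (- q))).
by rewrite addr0 addrK [q + t]addrC addrK.
Qed.

Lemma cobounding_opp p q r : cobounding p q r -> cobounding (- p) (- q) (- r).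
Proof.
move=> /coboundingN /coboundingD /(_ (cobounding0 (- p - q))).
by rewrite addr0 [q + _]addrC addrNK [p + _]addrA subrr add0r.
Qed.

Definition pair_equiv (p q : cocycle_pair) : bool := `[< ext_equiv (val p) (val q) >].

Lemma pair_equivP (p q : cocycle_pair) :
  reflect (exists r, cobounding (val p) (val q) r) (pair_equiv p q).
Proof.
have e := ext_equivP (cocycle_pairP p) (cocycle_pairP q).
by exact: (equivP (asboolP _) e).
Qed.

Fact pair_equiv_is_equiv : equiv_class_of pair_equiv.
Proof.
split=> [p|p q|q p t]; first by apply/pair_equivP; exists 0; exact: cobounding0.
  by apply/pair_equivP/pair_equivP => -[r /coboundingN h]; exists (- r).
move=> /pair_equivP[r h] /pair_equivP[r' h']; apply/pair_equivP.
by exists (r + r'); exact: cobounding_trans h h'.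
Qed.
Canonical pair_equiv_equiv := EquivRelPack pair_equiv_is_equiv.
Canonical pair_equiv_encModRel := defaultEncModRel pair_equiv.

Definition Opext := {eq_quot pair_equiv}.
HB.instance Definition _ := EqQuotient.on Opext.
HB.instance Definition _ := Choice.on Opext.

(* The Baer product, induced by the pointwise product of pairs. *)
Definition Opext_zero : Opext := lift_cst Opext 0.
Definition Opext_opp := lift_op1 Opext (-%R : cocycle_pair -> cocycle_pair).
Definition Opext_add := lift_op2 Opext (+%R : cocycle_pair -> _ -> _).

Canonical pi_Opext_zero := PiConst Opext_zero.

Fact pi_Opext_opp : {morph \pi_Opext : p / - p >-> Opext_opp p}.
Proof.
move=> p; unlock Opext_opp; apply/eqmodP/pair_equivP.
have /eqmodP/pair_equivP[r h] := esym (reprK (\pi_Opext p)).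
by exists (- r); rewrite !raddfN; exact: cobounding_opp h.
Qed.
Canonical pi_Opext_opp_morph := PiMorph1 pi_Opext_opp.

Fact pi_Opext_add : {morph \pi_Opext : p q / p + q >-> Opext_add p q}.
Proof.
move=> p q; unlock Opext_add; apply/eqmodP/pair_equivP.
have /eqmodP/pair_equivP[r h] := esym (reprK (\pi_Opext p)).
have /eqmodP/pair_equivP[r' h'] := esym (reprK (\pi_Opext q)).
by exists (r + r'); rewrite !raddfD; exact: coboundingD h h'.
Qed.
Canonical pi_Opext_add_morph := PiMorph2 pi_Opext_add.

Fact Opext_addA : associative Opext_add.
Proof. by move=> x y z; rewrite -[x]reprK -[y]reprK -[z]reprK !piE addrA. Qed.
Fact Opext_addC : commutative Opext_add.
Proof. by move=> x y; rewrite -[x]reprK -[y]reprK !piE addrC. Qed.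
Fact Opext_add0 : left_id Opext_zero Opext_add.
Proof. by move=> x; rewrite -[x]reprK !piE add0r. Qed.
Fact Opext_addN : left_inverse Opext_zero Opext_opp Opext_add.
Proof. by move=> x; rewrite -[x]reprK !piE addNr. Qed.
HB.instance Definition _ :=
  GRing.isZmodule.Build Opext Opext_addA Opext_addC Opext_add0 Opext_addN.

Lemma Opext_eqP (p q : cocycle_pair) :
  \pi_Opext p = \pi_Opext q <-> ext_equiv (val p) (val q).
Proof. by split=> [/eqmodP/asboolP|h]; last by apply/eqmodP/asboolP. Qed.

Lemma Opext_piD (p q : cocycle_pair) :
  \pi_Opext (p + q) = \pi_Opext p + \pi_Opext q.
Proof. exact: pi_Opext_add. Qed.

End Opext.

(* Meaningful for n >= 1 (it is Z/1 for n = 0).  'Z_n is not used because it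
   denotes Z/2 when n = 1. *)
Definition Zmod (n : nat) : Type := 'I_n.-1.+1.
HB.instance Definition _ n := FinRing.Zmodule.on (Zmod n).
HB.instance Definition _ n :=
  GRing.Zmodule_isComPzRing.Build (Zmod n) (@Zp_mulA _) (@Zp_mulC _)
    (@Zp_mul1z _) (@Zp_mul_addl _).

Definition mx22 (R : pzRingType) (a b c d : R) : 'M[R]_2 :=
  \matrix_(i < 2, j < 2) nth 0 (nth [::] [:: [:: a; b]; [:: c; d]] i) j.

Lemma det_mx22 (R : comPzRingType) (a b c d : R) :
  \det (mx22 a b c d) = a * d - b * c.
Proof.
rewrite (expand_det_row _ 0) big_ord_recl big_ord1 /cofactor /= !det_mx11 !mxE /=.
by rewrite expr0 mul1r expr1 mulN1r mulrN.
Qed.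

Lemma mx22_sqr (R : comPzRingType) (a b c : R) :
  \det (mx22 a b c (- a)) = -1 ->
  mx22 a b c (- a) *m mx22 a b c (- a) = 1%:M.
Proof.
rewrite det_mx22 mulrN -opprD => /oppr_inj e; apply/matrixP => i j.
rewrite !mxE big_ord_recl big_ord1 !mxE /=.
case: i j => [[|[|//]] ?] [[|[|//]] ?] //=.
- by rewrite mulrN [b * a]mulrC subrr.
- by rewrite mulNr [c * a]mulrC subrr.
by rewrite mulrNN addrC [c * b]mulrC.
Qed.

Section MatrixAction.
Variables (n : nat) (A : 'M[Zmod n]_2).

Section Action.
Hypothesis AA : A *m A = 1%:M.

Definition mx_act (v : 'cV[Zmod n]_2) (x : 'Z_2) : 'cV[Zmod n]_2 := A ^+ x *m v.

Fact mx_act1 : mx_act^~ 1%g =1 id.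
Proof. by move=> v; rewrite /mx_act expr0 mul1mx. Qed.

Fact mx_actM v : act_morph mx_act v.
Proof.
move=> x y; rewrite /mx_act mulmxA -[_ *m A ^+ x]exprD addnC.
by rewrite -(@expr_mod _ 2 A (x + y)%N) // expr2.
Qed.

Canonical mx_action := TotalAction mx_act1 mx_actM.

Fact mx_is_groupAction : is_groupAction [set: 'cV[Zmod n]_2] mx_action.
Proof.
move=> x _; rewrite inE; apply/andP; split; first by apply/subsetP => u _; rewrite inE.
by apply/morphicP => u v _ _; rewrite !actpermE; exact: mulmxDr.
Qed.

Definition mx_groupAction : groupAction [set: 'Z_2] [set: 'cV[Zmod n]_2] :=
  GroupAction mx_is_groupAction.

Lemma mx_groupAction_gen v : mx_groupAction v 1%R = A *m v.
Proof. by rewrite /= /mx_act expr1. Qed.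
End Action.

Variable k : fieldType.
Local Notation H := (homU 'cV[Zmod n]_2 k).

Fact hom_op_subproof (psi : H) :
  [ffun v => val psi (A *m v)] \in @hom_pred 'cV[Zmod n]_2 k.
Proof.
by apply/hom_predP => s t; rewrite !ffunE -homUM; congr (val psi _); exact: mulmxDr.
Qed.

Definition hom_op (psi : H) : H := HomU (hom_op_subproof psi).

Fact hom_op_is_zmod_morphism : zmod_morphism hom_op.
Proof. by move=> psi chi; apply/val_inj/ffunP => v; rewrite !ffunE. Qed.
HB.instance Definition _ :=
  GRing.isZmodMorphism.Build H H hom_op hom_op_is_zmod_morphism.
End MatrixAction.
Arguments hom_op {n} A k psi.

(* Main.v *)
From HB Require Import structures.
Require Import Defs.
From mathcomp Require Import all_boot all_order all_fingroup all_algebra.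
From mathcomp Require Import boolp ring.

Set Implicit Arguments.
Unset Strict Implicit.
Unset Printing Implicit Defensive.

Import GRing.Theory.
Local Open Scope ring_scope.

(** Write U for the group of units of k, additively, N for (Z/n)^2, and A for the
    matrix, so that A^2 = 1.

    Over Z/2 a pair of cocycles is determined by its values at the generator: a
    map sigma : N -> U and a 2-cocycle tau : N x N -> U such that
    sigma (A s) = sigma s and sigma (s + t) - sigma s - sigma t =
    tau (s, t) + tau (A s, A t).  Two pairs are equivalent when they differ by
    (r + r o A, - dr) for some r : N -> U.  (The reduction is z2_pairE,
    z2_pair_cocycle, z2_cobounding and z2_coboundingE.)

    The invariant with values in mu_n(k) is zeta = tau (e1, e2) - tau (e2, e1),
    a commutator in the central extension of N by U with cocycle tau; hence it
    is n-torsion (cext_commutator_torsion).  If it vanishes, the extension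
    splits, because U is n-divisible: lifts of e1 and e2 can be chosen of order
    n, they commute, and their monomials form a section (cext_split).  Then tau
    can be removed and what remains of sigma is an A-invariant character of N,
    up to the characters psi + psi o A.  This accounts for
    Ker(A - I) / Im(A + I).

    It remains to realise every zeta, compatibly with sums.  Take
    tau (s, t) = zeta s_1 t_2.  The required sigma is a quadratic refinement of
    tau + tau o (A x A), namely eta * Q with 2 eta = zeta and
      Q (x, y) = a c x^2 + 2 b c x y - a b y^2.
    Three points need care, all at the prime 2.  First, eta * Q must depend on
    x and y modulo n only; it does when n^2 eta = 0, and such an eta exists by
    2n-divisibility of U (exists_half).  Second, Q (A v) = (a^2 + b c) Q (v), and
    a^2 + b c is 1 modulo n only, so integers representing a, b, c have to be
    chosen well for eta * Q to be A-invariant (exists_lifts).  Third, eta is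
    determined by zeta only up to some delta with 2 delta = 0; but then
    delta * Q = psi + psi o A for the character psi (x, y) = delta a (x + y)
    (qroot_norm), so the class does not depend on the choice.

    Consequently a class x and a pair (kappa, zeta) correspond when some chi
    representing kappa and some eta with 2 eta = zeta and n^2 eta = 0 make x the
    class of (chi + eta * Q, zeta s_1 t_2).  This relation is additive, total on
    both sides and has trivial kernels, hence is the graph of an isomorphism
    (zmod_iso_of_rel). *)

(** * Isomorphisms from additive relations *)

(** The isomorphism of the theorem is easiest to describe by a relation, since
    neither direction has canonical representatives to be defined on. *)
Lemma zmod_iso_of_rel (V W : zmodType) (R : V -> W -> Prop) :
  (forall v, exists w, R v w) -> (forall w, exists v, R v w) ->
  (forall v v' w w', R v w -> R v' w' -> R (v - v') (w - w')) ->
  (forall w, R 0 w -> w = 0) -> (forall v, R v 0 -> v = 0) ->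
  zmod_iso V W.
Proof.
move=> totl totr RB R0 R0'.
have [f fP] := choice totl; have [g gP] := choice totr.
have fun_R v w w' : R v w -> R v w' -> w = w'.
  move=> h h'; apply/eqP; rewrite -subr_eq0; apply/eqP/R0.
  by rewrite -(subrr v); exact: RB.
have inj_R v v' w : R v w -> R v' w -> v = v'.
  move=> h h'; apply/eqP; rewrite -subr_eq0; apply/eqP/R0'.
  by rewrite -(subrr w); exact: RB.
have fB : zmod_morphism f by move=> v v'; apply: fun_R (fP _) _; exact: RB.
pose mf := GRing.isZmodMorphism.Build V W f fB.
pose F : {additive V -> W} := HB.pack f mf.
exists F; exists g => [v|w]; first exact: inj_R (gP _) (fP _).
exact: fun_R (fP _) (gP _).
Qed.

(** * Pairs of cocycles over Z/2 *)

Section PairsOverZ2.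
Variables (N : finGroupType) (k : fieldType).
Variable lhd : groupAction [set: 'Z_2] [set: N].
Local Notation U := (units k).
Local Notation gen := (1%R : 'Z_2).
Local Notation theta := (fun s : N => lhd s gen).

Definition z2_pair (sigma : N -> U) (tau : N -> N -> U) : cochains 'Z_2 N k :=
  ([ffun i : N * 'Z_2 * 'Z_2 =>
      if (i.1.2 == gen) && (i.2 == gen) then sigma i.1.1 else 0],
   [ffun i : N * N * 'Z_2 => if i.2 == gen then tau i.1.1 i.1.2 else 0]).

Lemma Z2P (x : 'Z_2) : x = 1%g \/ x = gen.
Proof. by case: x => [[|[|//]] ?]; [left|right]; apply: val_inj. Qed.

Lemma gen_neq1 : ((1%g : 'Z_2) == gen) = false. Proof. by []. Qed.
Lemma gen_sqr : (gen * gen)%g = 1%g :> 'Z_2. Proof. by apply: val_inj. Qed.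

(** The normalisation and cocycle conditions on the other values of the pair
    are consequences of these, by inspection of the elements of Z/2. *)
Lemma z2_pair_cocycle (sigma : N -> U) (tau : N -> N -> U) :
  (forall s, tau s 1%g = 0) -> (forall t, tau 1%g t = 0) ->
  (forall s t r, tau (s * t)%g r + tau s t = tau s (t * r)%g + tau t r) ->
  (forall s, sigma (theta s) = sigma s) ->
  (forall s t, sigma (s * t)%g =
     sigma s + sigma t + tau s t + tau (theta s) (theta t)) ->
  is_cocycle_pair lhd (z2_pair sigma tau).
Proof.
move=> t1r t1l tC sI sM.
split=> [s x|s y|s x|t x|s x y z|s t r x|s t x y]; rewrite !ffunE /=
  ?gen_neq1 ?andbF //.
- by case: ifP.
- by case: ifP.
- case: (Z2P x) => ->; case: (Z2P y) => ->; case: (Z2P z) => ->;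
    by rewrite ?gen_sqr ?mulg1 ?mul1g ?act1 ?gen_neq1 ?eqxx /= ?addr0 ?add0r ?sI.
- by case: (Z2P x) => ->; rewrite ?gen_neq1 ?eqxx ?addr0.
case: (Z2P x) => ->; case: (Z2P y) => ->;
    by rewrite ?gen_sqr ?mulg1 ?mul1g ?act1 ?gen_neq1 ?eqxx /= ?addr0 ?add0r ?sM.
Qed.

Section FromCocyclePair.
Variables (p : cochains 'Z_2 N k) (pP : is_cocycle_pair lhd p).

Definition pair_sigma s := p.1 (s, gen, gen).
Definition pair_tau s t := p.2 (s, t, gen).

(** The compatibility condition at x = y = 1 reads tau = tau + tau. *)
Lemma pair_tau_at_1 s t : p.2 (s, t, 1%g) = 0.
Proof.
have := sigma_tau_compat pP s t 1%g 1%g.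
by rewrite !(sigma1l pP) !act1 mulg1 !add0r => /eqP; rewrite -subr_eq subrr => /eqP <-.
Qed.

Lemma z2_pairE : p = z2_pair pair_sigma pair_tau.
Proof.
rewrite [LHS]surjective_pairing; congr (_, _); apply/ffunP => -[[s t] x]; rewrite ffunE /=.
  case: (Z2P t) => ->; first by rewrite gen_neq1 (sigma1l pP).
  by case: (Z2P x) => ->; rewrite eqxx ?gen_neq1 ?(sigma1r pP).
by case: (Z2P x) => ->; rewrite ?eqxx ?gen_neq1 ?pair_tau_at_1.
Qed.

Lemma pair_sigmaI s : pair_sigma (theta s) = pair_sigma s.
Proof.
have := sigma_cocycle pP s gen gen gen.
by rewrite gen_sqr (sigma1r pP) (sigma1l pP) !addr0.
Qed.

Lemma pair_sigmaM s t : pair_sigma (s * t)%g =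
  pair_sigma s + pair_sigma t + pair_tau s t + pair_tau (theta s) (theta t).
Proof.
by rewrite -(sigma_tau_compat pP) gen_sqr pair_tau_at_1 addr0.
Qed.

End FromCocyclePair.

Lemma z2_pairB sigma tau sigma' tau' :
  z2_pair sigma tau - z2_pair sigma' tau' =
  z2_pair (fun s => sigma s - sigma' s) (fun s t => tau s t - tau' s t).
Proof.
congr (_, _); apply/ffunP => i; rewrite !ffunE; by case: ifP => // _; rewrite subrr.
Qed.

Lemma z2_cobounding (sigma sigma' : N -> U) (tau tau' : N -> N -> U) (r : N -> U) :
  r 1%g = 0 ->
  (forall s, sigma s = sigma' s + (r s + r (theta s))) ->
  (forall s t, tau' s t + r (s * t)%g = tau s t + (r s + r t)) ->
  cobounding lhd (z2_pair sigma tau) (z2_pair sigma' tau')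
    [ffun i : N * 'Z_2 => if i.2 == gen then r i.1 else 0].
Proof.
move=> r1 rs rt; split=> [s|x|s x y|s t x]; rewrite !ffunE /=.
- by [].
- by case: ifP.
- case: (Z2P x) => ->; case: (Z2P y) => ->;
    by rewrite ?gen_sqr ?mulg1 ?mul1g ?act1 ?gen_neq1 ?eqxx /= ?addr0 ?add0r ?rs.
by case: (Z2P x) => ->; rewrite ?gen_neq1 ?eqxx ?addr0.
Qed.

Lemma z2_coboundingE (sigma sigma' : N -> U) (tau tau' : N -> N -> U)
    (rho : {ffun N * 'Z_2 -> U}) (r := fun s => rho (s, gen)) :
  cobounding lhd (z2_pair sigma tau) (z2_pair sigma' tau') rho ->
  (forall s, sigma s = sigma' s + (r s + r (theta s))) /\
  (forall s t, tau' s t + r (s * t)%g = tau s t + (r s + r t)).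
Proof.
case=> c1r c1l cs ct; split=> [s|s t].
  by have := cs s gen gen; rewrite !ffunE /= gen_sqr c1r addr0.
by have := ct s t gen; rewrite !ffunE.
Qed.

End PairsOverZ2.

(** * Central extensions of a finite group *)

Section CentralExtension.
Variables (N : finGroupType) (U : zmodType).

Record cocycle2 := Cocycle2 {
  tau2 :> N -> N -> U;
  tau2_1r : forall s, tau2 s 1%g = 0;
  tau2_1l : forall t, tau2 1%g t = 0;
  tau2_cocycle : forall s t r,
    tau2 (s * t)%g r + tau2 s t = tau2 s (t * r)%g + tau2 t r }.

Variable tau : cocycle2.

(** The twisted product below depends on tau, hence the phantom parameter. *)
Definition cext (tau : cocycle2) : Type := (U * N)%type.
HB.instance Definition _ := Choice.on (cext tau).

Definition cext_one : cext tau := (0, 1%g).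
Definition cext_mul (g h : cext tau) : cext tau :=
  (g.1 + h.1 + tau g.2 h.2, (g.2 * h.2)%g).

Fact cext_mulA : associative cext_mul.
Proof.
move=> [u s] [v t] [w r]; rewrite /cext_mul /= mulgA; congr (_, _).
rewrite [LHS](AC ((1*3)*1) (1*2*3*(5*4))) [RHS](ACl (1*2*4*(5*3))) /=.
by rewrite tau2_cocycle.
Qed.
Fact cext_mul1 : left_id cext_one cext_mul.
Proof. by move=> [u s]; rewrite /cext_mul /= tau2_1l mul1g add0r addr0. Qed.
Fact cext_1mul : right_id cext_one cext_mul.
Proof. by move=> [u s]; rewrite /cext_mul /= tau2_1r mulg1 !addr0. Qed.
HB.instance Definition _ :=
  isMonoid.Build (cext tau) cext_mulA cext_mul1 cext_1mul.

Lemma cextM (g h : cext tau) : (g * h)%g = (g.1 + h.1 + tau g.2 h.2, (g.2 * h.2)%g).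
Proof. by []. Qed.

Lemma cextX_snd (g : cext tau) i : (g ^+ i)%g.2 = (g.2 ^+ i)%g.
Proof. by elim: i => // i IH; rewrite !expgS cextM /= IH. Qed.

Definition central (u : U) : cext tau := (u, 1%g).

Lemma centralM u (g : cext tau) : (central u * g)%g = (u + g.1, g.2).
Proof. by rewrite cextM tau2_1l mul1g addr0. Qed.

Lemma central_commute u (g : cext tau) : commute (central u) g.
Proof.
by rewrite /commute centralM cextM tau2_1r mulg1 addr0 addrC.
Qed.

Lemma centralX u i : (central u ^+ i)%g = central (u *+ i).
Proof. by elim: i => // i IH; rewrite expgS IH centralM mulrS. Qed.

(** The commutator z of the lifts g1 and g2 is central, so g1^n g2 = z^n g2 g1^n;
    and g1^n is central because it lies over e1^n = 1. *)
Lemma cext_commutator_torsion n (e1 e2 : N) :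
  commute e1 e2 -> (e1 ^+ n = 1)%g -> (tau e1 e2 - tau e2 e1) *+ n = 0.
Proof.
move=> ce e1n; set z := tau e1 e2 - tau e2 e1.
pose g1 : cext tau := (0, e1); pose g2 : cext tau := (0, e2).
have g12 : (g1 * g2 = central z * (g2 * g1))%g.
  by rewrite centralM !cextM /= ce !add0r subrK.
have g1Xg2 i : (g1 ^+ i * g2 = central (z *+ i) * (g2 * g1 ^+ i))%g.
  elim: i => [|i IH]; first by rewrite mulr0n !expg0 mul1g mulg1 centralM add0r.
  rewrite -[in RHS]centralX [in RHS]expgSr centralX [in LHS]expgS -mulgA IH.
  by rewrite mulgA -(central_commute _ g1) -mulgA [in LHS](mulgA g1) g12 expgS -!mulgA.
have g1n : (g1 ^+ n)%g = central (g1 ^+ n)%g.1.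
  by rewrite [LHS]surjective_pairing cextX_snd /= e1n.
have := g1Xg2 n; rewrite g1n -(central_commute _ g2) !centralM => -[].
by rewrite -[LHS]add0r => /addIr.
Qed.

(** Divisibility of U corrects the lifts of e1 and e2 to lifts g1 and g2 of order
    dividing n; they commute since tau e1 e2 = tau e2 e1.  So (i, j) |-> g1^i g2^j
    is multiplicative and n-periodic, and r is its component in U. *)
Lemma cext_split n (e1 e2 : N) :
  (forall u : U, exists v, u = v *+ n) ->
  (e1 ^+ n = 1)%g -> (e2 ^+ n = 1)%g -> commute e1 e2 -> tau e1 e2 = tau e2 e1 ->
  exists r : nat -> nat -> U,
    (forall i j, r (i %% n)%N (j %% n)%N = r i j) /\
    (forall i j i' j', r (i + i')%N (j + j')%N =
       r i j + r i' j' + tau (e1 ^+ i * e2 ^+ j)%g (e1 ^+ i' * e2 ^+ j')%g).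
Proof.
move=> Udiv e1n e2n ce te.
have lift_e e : (e ^+ n = 1)%g -> exists u, (((u, e) : cext tau) ^+ n = 1)%g.
  move=> en; pose h : cext tau := (0, e).
  have hn : (h ^+ n)%g = central (h ^+ n)%g.1.
    by rewrite [LHS]surjective_pairing cextX_snd /= en.
  have [v vE] := Udiv (- (h ^+ n)%g.1); exists v.
  have -> : (v, e) = (central v * h)%g by rewrite centralM addr0.
  rewrite expgMn; last exact: central_commute.
  by rewrite centralX -vE hn centralM /= addNr.
have [u1 g1n] := lift_e _ e1n; have [u2 g2n] := lift_e _ e2n.
set g1 : cext tau := (u1, e1) in g1n; set g2 : cext tau := (u2, e2) in g2n.
have cg : commute g1 g2.
  by rewrite /commute !cextM /= ce te [u2 + _]addrC.
exists (fun i j => (g1 ^+ i * g2 ^+ j)%g.1); split=> [i j|i j i' j'].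
  have Xmod (g : cext tau) m : (g ^+ n = 1)%g -> (g ^+ (m %% n))%g = (g ^+ m)%g.
    by move=> gn; rewrite {2}(divn_eq m n) expgnDr mulnC expgnA gn expg1n mul1g.
  by rewrite !Xmod.
have -> : (g1 ^+ (i + i') * g2 ^+ (j + j') =
           (g1 ^+ i * g2 ^+ j) * (g1 ^+ i' * g2 ^+ j'))%g.
  rewrite !expgnDr -!mulgA; congr (_ * _)%g; rewrite !mulgA; congr (_ * _)%g.
  exact: commuteX2.
by rewrite cextM /= !cextX_snd.
Qed.

End CentralExtension.

(** * Integer representatives modulo n *)

Lemma int_parity (z : int) : exists h, z = 2 * h \/ z = 2 * h + 1.
Proof.
exists (z %/ 2)%Z; have := divz_eq z 2; have := modz_ge0 z (isT : 2 != 0 :> int).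
have := ltz_mod z (isT : 2 != 0 :> int).
by case: (z %% 2)%Z => [[|[|//]]|//] _ _ e; [left|right]; rewrite {1}e mulrC ?addr0.
Qed.

Lemma int_sqr_mod2 (z : int) : exists h, z * z = z + 2 * h.
Proof.
have [h [->|->]] := int_parity z; first by exists (h * (2 * h - 1)); ring.
by exists (h * (2 * h + 1)); ring.
Qed.

Section IntegerLifts.
Variables (n : nat) (n_ge1 : (1 <= n)%N).

Definition int_rep (x : Zmod n) : int := (val x)%:Z.

Lemma val_ZmodD (x y : Zmod n) : val (x + y) = ((val x + val y) %% n)%N.
Proof.
have nE i : (i %% n.-1.+1 = i %% n)%N by rewrite prednK.
exact: nE.
Qed.

Lemma val_Zmod_nat i : val (i%:R : Zmod n) = (i %% n)%N.
Proof.
elim: i => [|i IH]; first by rewrite mod0n.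
rewrite mulrSr val_ZmodD IH modnDml.
have nE j : (j %% n.-1.+1 = j %% n)%N by rewrite prednK.
rewrite -[in RHS]addn1 -[in RHS]modnDmr; congr ((_ + _) %% _)%N.
exact: nE.
Qed.

Lemma int_repK x : (int_rep x)%:~R = x.
Proof.
apply: val_inj; rewrite /int_rep -pmulrn val_Zmod_nat modn_small //.
by apply: (leq_trans (ltn_ord x)); rewrite prednK.
Qed.

Lemma intr_Zmod_eq (z z' : int) :
  z%:~R = z'%:~R :> Zmod n -> exists w, z = z' + n%:Z * w.
Proof.
move=> e.
suff h (d : int) : d%:~R = 0 :> Zmod n -> exists w, d = n%:Z * w.
  have [|w dE] := h (z - z'); first by rewrite intrB e subrr.
  by exists w; rewrite -dE addrC subrK.
have hnat i : i%:R = 0 :> Zmod n -> exists w, i%:Z = n%:Z * w.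
  move=> /(congr1 val); rewrite val_Zmod_nat /= => i0.
  by exists (i %/ n)%N%:Z; rewrite {1}(divn_eq i n) i0 addn0 PoszM mulrC.
case: (intP d) => [|i|i] d0; first by exists 0; rewrite mulr0.
  by apply: hnat; rewrite pmulrn.
have [|w dE] := hnat i.+1; last by exists (- w); rewrite dE mulrN.
by apply/eqP; rewrite -oppr_eq0 pmulrn -intrN d0.
Qed.

Lemma int_repP (x : Zmod n) (z : int) :
  x = z%:~R -> exists w, int_rep x = z + n%:Z * w.
Proof. by move=> e; apply: intr_Zmod_eq; rewrite int_repK. Qed.

(** The two divisibility conditions are what makes eta * Q invariant under A.
    Let a^2 + b c = 1 + n w for arbitrary representatives.  If n = 2 h + 1, then
    n = n^2 - 2 n h, so every multiple of n is a combination of n^2 and 2n.  If n is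
    even, w a c and w a b must be made even: when c is odd, b + n w in place of b
    turns w into w (1 + c), which is even; likewise with c + n w when b is odd;
    and when b and c are both even nothing has to be changed. *)
Lemma exists_lifts (a b c : Zmod n) : a * a + b * c = 1 ->
  exists la lb lc : int, [/\ la%:~R = a, lb%:~R = b, lc%:~R = c,
    exists P R, (la * la + lb * lc - 1) * (la * lc) = n%:Z * n%:Z * P + 2 * n%:Z * R &
    exists P R, (la * la + lb * lc - 1) * (la * lb) = n%:Z * n%:Z * P + 2 * n%:Z * R].
Proof.
have [h nE] := int_parity n%:Z.
move=> abc; have [w wE] : exists w, int_rep a * int_rep a + int_rep b * int_rep c = 1 + n%:Z * w.
  by apply: intr_Zmod_eq; rewrite rmorphD !rmorphM /= !int_repK.
have zn z (x : Zmod n) : (int_rep x + n%:Z * z)%:~R = x.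
  rewrite intrD intrM int_repK; have -> : n%:Z%:~R = 0 :> Zmod n.
    by apply: val_inj; rewrite -pmulrn val_Zmod_nat modnn.
  by rewrite mul0r addr0.
(* First the odd case, where 1 = n - 2 h. *)
case: nE => nE; last first.
  exists (int_rep a), (int_rep b), (int_rep c); rewrite !int_repK wE; split=> //.
    exists (w * (int_rep a * int_rep c)), (- h * w * (int_rep a * int_rep c)).
    by rewrite nE; ring.
  exists (w * (int_rep a * int_rep b)), (- h * w * (int_rep a * int_rep b)).
  by rewrite nE; ring.
have [hb bE] := int_parity (int_rep b); have [hc cE] := int_parity (int_rep c).
case: cE => cE; last first.
  exists (int_rep a), (int_rep b + n%:Z * w), (int_rep c); rewrite !int_repK zn.
  have -> : int_rep a * int_rep a + (int_rep b + n%:Z * w) * int_rep c - 1 =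
      2 * n%:Z * (w * (hc + 1)).
    by rewrite mulrDl addrA wE cE; ring.
  split=> //; first by exists 0, (w * (hc + 1) * (int_rep a * int_rep c)); ring.
  by exists 0, (w * (hc + 1) * (int_rep a * (int_rep b + n%:Z * w))); ring.
case: bE => bE; last first.
  exists (int_rep a), (int_rep b), (int_rep c + n%:Z * w); rewrite !int_repK zn.
  have -> : int_rep a * int_rep a + int_rep b * (int_rep c + n%:Z * w) - 1 =
      2 * n%:Z * (w * (hb + 1)).
    by rewrite mulrDr addrA wE bE; ring.
  split=> //; first by exists 0, (w * (hb + 1) * (int_rep a * (int_rep c + n%:Z * w))); ring.
  by exists 0, (w * (hb + 1) * (int_rep a * int_rep b)); ring.
exists (int_rep a), (int_rep b), (int_rep c); rewrite !int_repK wE; split=> //.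
  by exists 0, (w * int_rep a * hc); rewrite cE; ring.
by exists 0, (w * int_rep a * hb); rewrite bE; ring.
Qed.

End IntegerLifts.

(** * The quadratic form *)

(** For tau (s, t) = 2 s_1 t_2, the value of tau + tau o (A x A) at (v, v) is
    2 quad (v) modulo 2n, as 1 - a^2 = b c modulo n. *)
Definition quad (a b c x y : int) : int :=
  a * c * (x * x) + 2 * b * c * (x * y) - a * b * (y * y).

(** Multiples of eta by integers are computed modulo 2n, and modulo both 2n and
    n^2 when in addition n^2 eta = 0. *)
Section Torsion.
Variables (U : zmodType) (n : nat) (eta : U).
Hypothesis eta_2n : eta *~ (2 * n%:Z) = 0.

Lemma tors_eq2 z z' R : z = z' + 2 * n%:Z * R -> eta *~ z = eta *~ z'.
Proof.
by move=> ->; rewrite mulrzDr mulrzA eta_2n mul0rz addr0.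
Qed.

Hypothesis eta_nn : eta *~ (n%:Z * n%:Z) = 0.

Lemma tors_eq z z' P R :
  z = z' + (n%:Z * n%:Z * P + 2 * n%:Z * R) -> eta *~ z = eta *~ z'.
Proof.
by rewrite addrA => /tors_eq2 ->; rewrite mulrzDr mulrzA eta_nn mul0rz addr0.
Qed.

Lemma quad_periodic a b c x y w v :
  eta *~ quad a b c (x + n%:Z * w) (y + n%:Z * v) = eta *~ quad a b c x y.
Proof.
apply: (@tors_eq _ _ (a * c * (w * w) - a * b * (v * v))
  (a * c * (x * w) + b * c * (x * v + w * y + n%:Z * (w * v)) - a * b * (v * y))).
by rewrite /quad; ring.
Qed.

End Torsion.

Section QuadraticFamily.
Variables (n : nat) (n_ge1 : (1 <= n)%N) (U : zmodType) (la lb lc : int).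
Local Notation N := 'cV[Zmod n]_2.
Local Notation A := (mx22 (la%:~R : Zmod n) lb%:~R lc%:~R (- la%:~R)).
Local Notation X s := (int_rep ((s : N) 0 0)).
Local Notation Y s := (int_rep ((s : N) 1 0)).

Hypothesis detA : \det A = -1.
Hypothesis lifts_ac : exists P R,
  (la * la + lb * lc - 1) * (la * lc) = n%:Z * n%:Z * P + 2 * n%:Z * R.
Hypothesis lifts_ab : exists P R,
  (la * la + lb * lc - 1) * (la * lb) = n%:Z * n%:Z * P + 2 * n%:Z * R.

Lemma lifts_square : exists u, la * la + lb * lc = 1 + n%:Z * u.
Proof.
apply: intr_Zmod_eq => //; rewrite intrD !intrM.
by move: detA; rewrite det_mx22 mulrN -opprD => /oppr_inj.
Qed.

Lemma mulA_coords (s : N) :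
  (A *m s) 0 0 = la%:~R * s 0 0 + lb%:~R * s 1 0 /\
  (A *m s) 1 0 = lc%:~R * s 0 0 - la%:~R * s 1 0.
Proof.
have e1 : fintype.lift ord0 ord0 = 1 :> 'I_2 by apply: val_inj.
by split; rewrite !mxE big_ord_recl big_ord1 !mxE /= e1 // mulNr.
Qed.

Lemma X_mulA s : exists w, X (A *m s) = la * X s + lb * Y s + n%:Z * w.
Proof. by apply: int_repP => //; rewrite (mulA_coords s).1 intrD !intrM !int_repK. Qed.

Lemma Y_mulA s : exists w, Y (A *m s) = lc * X s - la * Y s + n%:Z * w.
Proof. by apply: int_repP => //; rewrite (mulA_coords s).2 intrB !intrM !int_repK. Qed.

Lemma X_add s t : exists w, X (s + t) = X s + X t + n%:Z * w.
Proof. by apply: int_repP => //; rewrite mxE intrD !int_repK. Qed.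

Lemma Y_add s t : exists w, Y (s + t) = Y s + Y t + n%:Z * w.
Proof. by apply: int_repP => //; rewrite mxE intrD !int_repK. Qed.

Definition qpart (eta : U) (s : N) : U := eta *~ quad la lb lc (X s) (Y s).
Definition tpart (eta : U) (s t : N) : U := eta *~ (2 * (X s * Y t)).

Lemma qpartB eta eta' s : qpart (eta - eta') s = qpart eta s - qpart eta' s.
Proof. exact: mulrzBl. Qed.

Lemma tpartB eta eta' s t : tpart (eta - eta') s t = tpart eta s t - tpart eta' s t.
Proof. exact: mulrzBl. Qed.

Section Eta.
Variable eta : U.
Hypothesis eta_2n : eta *~ (2 * n%:Z) = 0.
Local Notation q := (qpart eta).
Local Notation tau := (tpart eta).

Lemma tpartDl s s' t : tau (s + s') t = tau s t + tau s' t.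
Proof.
have [w wE] := X_add s s'; rewrite /tpart -mulrzDr.
by apply: (tors_eq2 eta_2n (R := w * Y t)); rewrite wE; ring.
Qed.

Lemma tpartDr s t t' : tau s (t + t') = tau s t + tau s t'.
Proof.
have [w wE] := Y_add t t'; rewrite /tpart -mulrzDr.
by apply: (tors_eq2 eta_2n (R := w * X s)); rewrite wE; ring.
Qed.

Lemma tpart0l t : tau 0 t = 0.
Proof. by apply: (addIr (tau 0 t)); rewrite -tpartDl !add0r. Qed.

Lemma tpart0r s : tau s 0 = 0.
Proof. by apply: (addIr (tau s 0)); rewrite -tpartDr !add0r. Qed.

Lemma tpart_cocycle s t r : tau (s + t) r + tau s t = tau s (t + r) + tau t r.
Proof. by rewrite tpartDl tpartDr [LHS]addrC addrA. Qed.

Hypothesis eta_nn : eta *~ (n%:Z * n%:Z) = 0.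

(** On integers the form satisfies Q (A v) = (a^2 + b c) Q (v); the choice of the
    representatives kills the multiples of a^2 + b c - 1 by a c and a b, and the
    mixed coefficient 2 b c is killed by 2n. *)
Lemma qpart_mulA s : q (A *m s) = q s.
Proof.
have [w wE] := X_mulA s; have [v vE] := Y_mulA s.
rewrite /qpart wE vE quad_periodic //.
have [u uE] := lifts_square.
have [P [R PR]] := lifts_ac; have [P' [R' PR']] := lifts_ab.
apply: (tors_eq eta_2n eta_nn (P := P * (X s * X s) - P' * (Y s * Y s))
  (R := R * (X s * X s) - R' * (Y s * Y s) + u * lb * lc * (X s * Y s))).
transitivity (quad la lb lc (X s) (Y s)
  + ((la * la + lb * lc - 1) * (la * lc)) * (X s * X s)
  - ((la * la + lb * lc - 1) * (la * lb)) * (Y s * Y s)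
  + 2 * (la * la + lb * lc - 1) * lb * lc * (X s * Y s)).
  by rewrite /quad; ring.
by rewrite PR PR' uE; ring.
Qed.

Lemma qpartD s t : q (s + t) = q s + q t + tau s t + tau (A *m s) (A *m t).
Proof.
have [w wE] := X_mulA s; have [v vE] := Y_mulA t.
have [w' wE'] := X_add s t; have [v' vE'] := Y_add s t.
rewrite /qpart wE' vE' quad_periodic // /tpart -!mulrzDr.
have [u uE] := lifts_square.
rewrite wE vE; set x := X s; set y := Y s; set x' := X t; set y' := Y t.
apply: (tors_eq2 eta_2n (R := u * (x * y')
   - (w * (lc * x' - la * y' + n%:Z * v) + (la * x + lb * y) * v))).
transitivity (quad la lb lc x y + quad la lb lc x' y'
   + 2 * (x * y') + 2 * ((la * x + lb * y) * (lc * x' - la * y'))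
   + 2 * (la * la + lb * lc - 1) * (x * y')).
  by rewrite /quad; ring.
by rewrite uE; ring.
Qed.

End Eta.

(** Two solutions eta of 2 eta = zeta differ by an element such as delta. *)
Section TwoTorsion.
Variable delta : U.
Hypothesis delta_2 : delta *~ 2 = 0.
Hypothesis delta_nn : delta *~ (n%:Z * n%:Z) = 0.

Lemma two_tors_eq z z' R : z = z' + 2 * R -> delta *~ z = delta *~ z'.
Proof. by move=> ->; rewrite mulrzDr mulrzA delta_2 mul0rz addr0. Qed.

(** Because n^2 and n have the same parity. *)
Lemma two_tors_n : delta *~ n%:Z = 0.
Proof.
have [h hE] := int_sqr_mod2 n%:Z; rewrite -delta_nn; symmetry.
exact: two_tors_eq hE.
Qed.

Lemma two_tors_periodic z w : delta *~ (z + n%:Z * w) = delta *~ z.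
Proof. by rewrite mulrzDr mulrzA two_tors_n mul0rz addr0. Qed.

Definition qroot (s : N) : U := delta *~ (la * (X s + Y s)).

Lemma qrootD s t : qroot (s + t) = qroot s + qroot t.
Proof.
have [w wE] := X_add s t; have [v vE] := Y_add s t.
rewrite /qroot -mulrzDr wE vE.
transitivity (delta *~ (la * (X s + Y s) + la * (X t + Y t) + n%:Z * (la * (w + v)))).
  by congr (_ *~ _); ring.
exact: two_tors_periodic.
Qed.

(** Modulo 2 one has z^2 = z, so Q (x, y) = a c x + a b y, while the right-hand
    side is a (x + y) + a ((a x + b y) + (c x - a y)) and a + a^2 = 0. *)
Lemma qroot_norm s : qpart delta s = qroot s + qroot (A *m s).
Proof.
have [w wE] := X_mulA s; have [v vE] := Y_mulA s.
rewrite /qroot -mulrzDr wE vE /qpart; set x := X s; set y := Y s.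
have [h hE] := int_sqr_mod2 x; have [j jE] := int_sqr_mod2 y.
have [i iE] := int_sqr_mod2 la.
transitivity (delta *~ (la * (x + y) +
   la * (la * x + lb * y + (lc * x - la * y)) + n%:Z * (la * (w + v)))); last first.
  by congr (_ *~ _); ring.
rewrite two_tors_periodic.
apply: (two_tors_eq (R := la * lc * h + lb * lc * (x * y) - la * lb * (j + y)
  - la * x - i * (x - y))).
have la2 : la * (la * (x - y)) = (la + 2 * i) * (x - y) by rewrite mulrA iE.
transitivity (la * (x + y) + la * (lb * y + lc * x) + la * (la * (x - y)) +
  2 * (la * lc * h + lb * lc * (x * y) - la * lb * (j + y) - la * x - i * (x - y))).
  by rewrite la2 /quad hE jE; ring.
by ring.
Qed.

End TwoTorsion.
End QuadraticFamily.

Lemma additive_at0 (V W : zmodType) (f : V -> W) :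
  (forall s t, f (s + t) = f s + f t) -> f 0 = 0.
Proof. by move=> fD; apply: (addIr (f 0)); rewrite -fD !add0r. Qed.

Lemma units_divisible (k : fieldType) m :
  (forall x : k, x != 0 -> exists2 y : k, y != 0 & x = y ^+ m) ->
  forall u : units k, exists v, u = v *+ m.
Proof.
move=> kdiv u; have [y y0 uE] := kdiv (val u) (units_neq0 u).
by exists (Units y0); apply: val_inj; rewrite val_unitsMn.
Qed.

(** If n is even, half of zeta is killed by 2n, which divides n^2.  If n is odd,
    the half of zeta is taken inside the n-torsion, as ((n + 1) / 2) zeta. *)
Lemma exists_half (U : zmodType) n (zeta : U) :
  (forall u : U, exists v, u = v *+ (2 * n)) -> (1 <= n)%N -> zeta *+ n = 0 ->
  exists eta, eta *~ 2 = zeta /\ eta *~ (n%:Z * n%:Z) = 0.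
Proof.
move=> Udiv n_ge1 zn; have zn' : zeta *~ n%:Z = 0 by rewrite -pmulrn.
have [h [] nE] := int_parity n%:Z.
  have [v vE] := Udiv zeta; exists (v *+ n).
  have e : v *+ n *~ 2 = zeta by rewrite -pmulrn -mulrnA mulnC -vE.
  by rewrite e {1}nE -mulrA mulrzA e mulrC mulrzA zn' mul0rz.
exists (zeta *~ (h + 1)); rewrite -!mulrzA; split.
  have -> : (h + 1) * 2 = n%:Z * 1 + 1 by rewrite nE; ring.
  by rewrite mulrzDr mulr1 zn' add0r.
by rewrite mulrCA mulrzA zn' mul0rz.
Qed.

(** * Classes of extensions *)

Section OpextOfFamily.
Variables (n : nat) (n_ge1 : (1 <= n)%N) (k : fieldType) (la lb lc : int).
Local Notation U := (units k).
Local Notation N := 'cV[Zmod n]_2.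
Local Notation A := (mx22 (la%:~R : Zmod n) lb%:~R lc%:~R (- la%:~R)).

Hypothesis detA : \det A = -1.
Hypothesis lifts_ac : exists P R,
  (la * la + lb * lc - 1) * (la * lc) = n%:Z * n%:Z * P + 2 * n%:Z * R.
Hypothesis lifts_ab : exists P R,
  (la * la + lb * lc - 1) * (la * lb) = n%:Z * n%:Z * P + 2 * n%:Z * R.

Local Notation act := (mx_groupAction (mx22_sqr detA)).
Local Notation q := (qpart la lb lc).

Definition family_pair (chi : N -> U) (eta : U) : cochains 'Z_2 N k :=
  z2_pair (fun s => chi s + q eta s) (tpart eta).

Lemma family_pair_cocycle chi eta :
  (forall s t, chi (s + t) = chi s + chi t) -> (forall s, chi (A *m s) = chi s) ->
  eta *~ (2 * n%:Z) = 0 -> eta *~ (n%:Z * n%:Z) = 0 ->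
  is_cocycle_pair act (family_pair chi eta).
Proof.
move=> chiD chiA e2n enn.
apply: z2_pair_cocycle => [s|t|s t r|s|s t].
- exact: tpart0r.
- exact: tpart0l.
- exact: tpart_cocycle.
- by rewrite mx_groupAction_gen chiA qpart_mulA.
rewrite !mx_groupAction_gen -!addrA.
have -> : (s * t)%g = s + t by [].
rewrite chiD qpartD //.
by rewrite -!addrA; congr (_ + _); rewrite [RHS]addrCA.
Qed.

Local Notation e1 := (delta_mx 0 0 : N).
Local Notation e2 := (delta_mx 1 0 : N).

(** With tpart_e21, this says that the commutator invariant of the family is
    zeta = 2 eta. *)
Lemma tpart_e12 (eta : U) : eta *~ (2 * n%:Z) = 0 -> tpart eta e1 e2 = eta *~ 2.
Proof.
move=> e2n; rewrite /tpart !mxE /=.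
have [|w ->] := @int_repP n n_ge1 1 1; first by [].
apply: (tors_eq2 e2n (R := w * (2 + n%:Z * w))); ring.
Qed.

Lemma tpart_e21 (eta : U) : tpart eta e2 e1 = 0.
Proof. by rewrite /tpart !mxE /= mul0r mulr0 mulr0z. Qed.

Lemma basis_exp (s : N) :
  s = (e1 ^+ val (s 0%R 0%R) * e2 ^+ val (s 1%R 0%R))%g.
Proof.
rewrite !FinRing.zmodXgE FinRing.zmodMgE; apply/matrixP => i j; rewrite !(mxE, mulmxnE).
have r x : (val (x : Zmod n))%:R = x by rewrite pmulrn; exact: int_repK.
case: i j => [[|[|//]] i2] [[|//] j1]; rewrite /= ?mul0rn ?addr0 ?add0r r;
  by congr (s _ _); apply: val_inj.
Qed.

Lemma basis_expn : (e1 ^+ n = 1)%g /\ (e2 ^+ n = 1)%g.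
Proof.
have nr : n%:R = 0 :> Zmod n by apply: val_inj; rewrite val_Zmod_nat // modnn.
by split; rewrite FinRing.zmodXgE -scaler_nat nr scale0r.
Qed.

Hypothesis Udiv : forall u : U, exists v, u = v *+ (2 * n).

Lemma Udivn (u : U) : exists v, u = v *+ n.
Proof. by have [v ->] := Udiv u; exists (v *+ 2); rewrite -mulrnA. Qed.

Lemma pair_tau_cocycle2 p : is_cocycle_pair act p ->
  exists tau : cocycle2 N U, forall s t, tau s t = pair_tau p s t.
Proof.
move=> pP.
have t1 s : pair_tau p s 1%g = 0 by exact: tau1r pP _ _.
have t2 t : pair_tau p 1%g t = 0 by exact: tau1l pP _ _.
have t3 s t r : pair_tau p (s * t)%g r + pair_tau p s t =
    pair_tau p s (t * r)%g + pair_tau p t r by exact: tau_cocycle pP _ _ _ _.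
by exists (Cocycle2 t1 t2 t3).
Qed.

(** The map r is read off from a multiplicative section of the central
    extension with cocycle tau. *)
Lemma cobounding_symmetric p : is_cocycle_pair act p ->
  pair_tau p e1 e2 = pair_tau p e2 e1 ->
  exists r : N -> U, r 0 = 0 /\
    forall s t, r (s + t) = r s + r t + pair_tau p s t.
Proof.
move=> pP te; have [tau tauE] := pair_tau_cocycle2 pP.
have ce : commute e1 e2 by exact: addrC.
have te' : tau e1 e2 = tau e2 e1 by rewrite !tauE.
have [r [rmod rD]] := cext_split Udivn basis_expn.1 basis_expn.2 ce te'.
pose r' (s : N) := r (val (s 0 0)) (val (s 1 0)).
have r'D s t : r' (s + t) = r' s + r' t + pair_tau p s t.
  rewrite -tauE [in tau _ _](basis_exp s) [in tau _ _](basis_exp t) -rD -rmod.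
  rewrite /r' !mxE !(val_ZmodD n_ge1); congr (r _ _).
exists r'; split=> //; have p0 : pair_tau p (0 : N) 0 = 0 by exact: tau1r pP _ _.
have := r'D 0 0; rewrite p0 !addr0 => r'00.
by apply: (addIr (r' 0)); rewrite add0r -r'00.
Qed.


(** Subtracting the member of the family with the same commutator invariant
    leaves a pair whose tau is the coboundary of some r; its sigma minus r + r o A
    is then an A-invariant character chi. *)
Lemma family_pair_surjective p : is_cocycle_pair act p ->
  exists (chi : N -> U) (eta : U),
    [/\ forall s t, chi (s + t) = chi s + chi t, forall s, chi (A *m s) = chi s,
        eta *~ 2 *~ n%:Z = 0, eta *~ (n%:Z * n%:Z) = 0
      & exists rho, cobounding act p (family_pair chi eta) rho].
Proof.
move=> pP; have [tau tauE] := pair_tau_cocycle2 pP.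
have ce : commute e1 e2 by exact: addrC.
have := cext_commutator_torsion tau ce basis_expn.1; rewrite !tauE.
set zeta := _ - _ => zn; have [eta [eta2 enn]] := exists_half Udiv n_ge1 zn.
have e2n : eta *~ (2 * n%:Z) = 0 by rewrite mulrzA eta2 -pmulrn.
have fP : is_cocycle_pair act (family_pair (fun=> 0) eta).
  by apply: family_pair_cocycle => // *; rewrite addr0.
pose p' := p - family_pair (fun=> 0) eta.
have p'P : is_cocycle_pair act p'.
  suff /asboolP : p' \in cocycle_pair_pred act by [].
  by apply: rpredB; apply/asboolP.
have tauB s t : pair_tau p' s t = pair_tau p s t - tpart eta s t.
  by rewrite /pair_tau !ffunE.
have sigmaB s : pair_sigma p' s = pair_sigma p s - q eta s.
  by rewrite /pair_sigma !ffunE /= add0r.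
have [|r [r0 rD]] := cobounding_symmetric p'P.
  rewrite !tauB tpart_e12 // tpart_e21 subr0 eta2 /zeta.
  by rewrite opprB addrC subrK.
have AK s : A *m (A *m s) = s by rewrite mulmxA mx22_sqr ?mul1mx.
exists (fun s => pair_sigma p' s - (r s + r (A *m s))), eta; split=> //.
- move=> s t; have := pair_sigmaM p'P s t.
  rewrite !mx_groupAction_gen => ->; rewrite mulmxDr !rD.
  rewrite [X in _ - X](_ : _ = (r s + r (A *m s)) + (r t + r (A *m t)) +
    (pair_tau p' s t + pair_tau p' (A *m s) (A *m t))).
    by rewrite -[X in X - _]addrA opprD addrACA subrr addr0 opprD addrACA.
  by rewrite [LHS](AC (3*3) ((1*4)*(2*5)*(3*6))).
- move=> s; have := pair_sigmaI p'P s; rewrite !mx_groupAction_gen => ->.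
  by rewrite AK [r _ + _]addrC.
- by rewrite eta2 -pmulrn.
exists [ffun i : N * 'Z_2 => if i.2 == 1 then r i.1 else 0].
rewrite [p in cobounding _ p](z2_pairE pP); apply: z2_cobounding => [|s|s t].
- exact: r0.
- by rewrite mx_groupAction_gen sigmaB addrAC subrK subrK.
rewrite rD tauB [in LHS]addrC -addrA subrK.
by rewrite addrC.
Qed.

Lemma tpart_two_tors (eta : U) (s t : N) : eta *~ 2 = 0 -> tpart eta s t = 0.
Proof. by move=> e2; rewrite /tpart mulrzA e2 mul0rz. Qed.

Lemma z2_pair0 : 0 = z2_pair (fun=> 0) (fun _ _ => 0) :> cochains 'Z_2 N k.
Proof. by congr (_, _); apply/ffunP => i; rewrite !ffunE; case: ifP. Qed.

(** A coboundary is symmetric, so triviality forces 2 eta = 0 by tpart_e12; then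
    tau = 0 and r is a character, as is qroot, which absorbs eta * Q. *)
Lemma family_pair_trivial chi eta :
  eta *~ (2 * n%:Z) = 0 -> eta *~ (n%:Z * n%:Z) = 0 ->
  (exists rho, cobounding act (family_pair chi eta) 0 rho) <->
  eta *~ 2 = 0 /\ exists psi : N -> U,
    (forall s t, psi (s + t) = psi s + psi t) /\
    (forall s, chi s = psi s + psi (A *m s)).
Proof.
move=> e2n enn; split.
  case=> rho; rewrite z2_pair0 => /z2_coboundingE [rs rt].
  pose r (s : N) := rho (s, 1).
  have rt' s t : r (s + t) = tpart eta s t + (r s + r t).
    by have := rt s t; rewrite add0r.
  have e2 : eta *~ 2 = 0.
    have := rt' e1 e2; rewrite addrC rt' tpart_e21 tpart_e12 // [r e2 + _]addrC.
    by move=> /addIr.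
  have rD s t : r (s + t) = r s + r t by rewrite rt' tpart_two_tors // add0r.
  split=> //; exists (fun s => r s - qroot la eta s); split=> [s t|s].
    by rewrite rD qrootD // opprD addrACA.
  have := rs s; rewrite add0r mx_groupAction_gen qroot_norm // => e.
  by rewrite addrACA -opprD -e addrK.
move=> [e2 [psi [psiD psiE]]].
have qD (s t : N) : qroot la eta (s + t) = qroot la eta s + qroot la eta t.
  exact: qrootD.
pose r s := psi s + qroot la eta s.
exists [ffun i : N * 'Z_2 => if i.2 == 1 then r i.1 else 0].
rewrite z2_pair0; apply: (z2_cobounding (r := r)) => [|s|s t]; rewrite /r.
- by rewrite (additive_at0 psiD) (additive_at0 qD) addr0.
- by rewrite mx_groupAction_gen add0r psiE qroot_norm // addrACA.
by rewrite tpart_two_tors // !add0r psiD qD addrACA.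
Qed.

End OpextOfFamily.

(** * The isomorphism *)

Lemma ker_modP (V : zmodType) (f g : {additive V -> V}) (x : Defs.ker f) :
  (\pi x = 0 :> ker_mod_im f g)%qT <-> exists y, val x = g y.
Proof.
rewrite -(raddf0 (\pi_(ker_mod_im f g)%qT)).
split=> [/eqP|h].
  by rewrite -Quotient.idealrBE subr0 => /asboolP.
by apply/eqP; rewrite -Quotient.idealrBE subr0; apply/asboolP.
Qed.

Theorem theorem5p2 (n : nat) (n_ge1 : (1 <= n)%N) (a b c : Zmod n)
    (detA : \det (mx22 a b c (- a)) = -1)
    (k : fieldType)
    (k_div : forall x : k, x != 0 -> exists2 y : k, y != 0 & x = y ^+ (2 * n)) :
  let A := mx22 a b c (- a) in
  zmod_iso
    (Opext k (mx_groupAction (mx22_sqr detA)))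
    (ker_mod_im (hom_op A k \- idfun) (hom_op A k \+ idfun) * mu n k)%type.
Proof.
move=> A; rewrite {}/A.
have Udiv := units_divisible k_div.
have abc : a * a + b * c = 1.
  by move: detA; rewrite det_mx22 mulrN -opprD => /oppr_inj.
have [la [lb [lc [ea eb ec lac lab]]]] := exists_lifts n_ge1 abc.
subst a b c.
set A := mx22 _ _ _ _; set act := mx_groupAction _.
set K := ker_mod_im _ _.
pose kerA := Defs.ker (hom_op A k \- idfun).
have chiD (psi : homU 'cV[Zmod n]_2 k) s t : val psi (s + t) = val psi s + val psi t.
  exact: homUM.
have kerP (chi : homU 'cV[Zmod n]_2 k) :
  chi \in ker_pred (hom_op A k \- idfun) <-> forall s, val chi (A *m s) = val chi s.
  split=> [/eqP/(congr1 val)/ffunP e s|e].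
    by have := e s; rewrite !ffunE => /eqP; rewrite subr_eq0 => /eqP.
  by apply/eqP/val_inj/ffunP => s; rewrite !ffunE e subrr.
have homP (f : 'cV[Zmod n]_2 -> units k) : (forall s t, f (s + t) = f s + f t) ->
    exists psi : homU 'cV[Zmod n]_2 k, forall s, val psi s = f s.
  move=> fD; have fP : [ffun s => f s] \in @hom_pred 'cV[Zmod n]_2 k.
    by apply/hom_predP => s t; rewrite !ffunE; exact: fD.
  by exists (HomU fP) => s; rewrite ffunE.
have tors2n (eta : units k) : eta *~ 2 *~ n%:Z = 0 -> eta *~ (2 * n%:Z) = 0.
  by rewrite mulrzA.
have muP (z : mu n k) : val z *~ n%:Z = 0.
  apply: val_inj; rewrite -pmulrn val_unitsMn; exact/eqP/(valP z).
pose R (x : Opext k act) (w : (K * mu n k)%type) :=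
  exists (chi : kerA) (eta : units k) (p : cocycle_pair k act),
  [/\ eta *~ (n%:Z * n%:Z) = 0, eta *~ 2 = val w.2,
      val p = family_pair la lb lc (val (val chi)) eta,
      (\pi p = x)%qT & (\pi chi = w.1 :> K)%qT].
have trivialP (p : cocycle_pair k act) : (\pi p = 0 :> Opext k act)%qT <->
    exists rho, cobounding act (val p) 0 rho.
  rewrite -(additive_at0 (@Opext_piD _ _ k act)) Opext_eqP.
  by apply: ext_equivP; exact: cocycle_pairP.
have family (chi : kerA) (eta : units k) :
    eta *~ (n%:Z * n%:Z) = 0 -> eta *~ (2 * n%:Z) = 0 ->
    exists p : cocycle_pair k act, val p = family_pair la lb lc (val (val chi)) eta.
  move=> enn e2n.
  have fP : family_pair la lb lc (val (val chi)) eta \in cocycle_pair_pred act.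
    apply/asboolP; apply: family_pair_cocycle => //.
    by apply/kerP; exact: valP.
  by exists (CocyclePair fP).
apply: (@zmod_iso_of_rel _ _ R).
(* Every class is a member of the family. *)
- move=> x; have pP := cocycle_pairP (generic_quotient.repr x).
  have [chi [eta [cD cA e2n enn [rho rhoP]]]] :=
    family_pair_surjective n_ge1 lac lab Udiv pP.
  have zP : eta *~ 2 \in @mu_pred n k.
    by rewrite inE -val_unitsMn pmulrn e2n.
  have [psi psiE] := homP chi cD.
  have cK : psi \in ker_pred (hom_op A k \- idfun) by apply/kerP => s; rewrite !psiE.
  have [p pE] := family (Ker cK) eta enn (tors2n _ e2n).
  exists (\pi_K%qT (Ker cK), Mu zP), (Ker cK), eta, p; split=> //.
  rewrite -[RHS]reprK; apply/Opext_eqP/ext_equivP; try exact: cocycle_pairP.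
  exists (- rho); apply: coboundingN; rewrite pE.
  rewrite (_ : family_pair _ _ _ _ _ = family_pair la lb lc chi eta) //.
  by congr (_, _); apply/ffunP => i; rewrite !ffunE psiE.
(* Every zeta has a suitable half eta. *)
- move=> [w z]; have [|eta [e2 enn]] := exists_half (zeta := val z) Udiv n_ge1.
    by rewrite pmulrn.
  have e2n : eta *~ (2 * n%:Z) = 0 by apply: tors2n; rewrite e2.
  have [p pE] := family (generic_quotient.repr w) eta enn e2n.
  exists (\pi_(Opext k act)%qT p), (generic_quotient.repr w), eta, p.
  by split=> //=; rewrite reprK.
- move=> x x' w w' [chi [eta [p [enn e2 pE <- wE]]]].
  move=> [chi' [eta' [p' [enn' e2' pE' <- wE']]]].
  exists (chi - chi'), (eta - eta'), (p - p'); split.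
  + by rewrite mulrzBl enn enn' subrr.
  + by rewrite mulrzBl e2 e2' raddfB.
  + rewrite raddfB /= pE pE' z2_pairB; congr (_, _); apply/ffunP => i; rewrite !ffunE.
      by rewrite qpartB [in RHS]addrACA -opprD.
    by rewrite tpartB.
  + by apply: (addIr (\pi_(Opext k act)%qT p')); rewrite -Opext_piD !subrK.
  transitivity (\pi_K%qT chi - \pi_K%qT chi'); first exact: raddfB.
  by rewrite wE wE'.
(* A trivial member of the family has trivial parameters, and conversely. *)
- move=> [w z] [chi [eta [p [enn e2 pE p0 wE]]]].
  have e2n : eta *~ (2 * n%:Z) = 0 by apply: tors2n; rewrite e2; exact: muP.
  move/trivialP: p0; rewrite pE => /(family_pair_trivial n_ge1 detA _ e2n enn).
  move=> [e20 [psi [psiD psiE]]]; congr (_, _).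
    transitivity (\pi_K%qT chi); first exact: esym wE.
    apply/ker_modP; have [phi phiE] := homP psi psiD; exists phi.
    by apply/val_inj/ffunP => s; rewrite !ffunE !phiE psiE addrC.
  by apply: val_inj; exact: etrans (esym e2) e20.
move=> x [chi [eta [p [enn e2 pE <- wE]]]].
have e2n : eta *~ (2 * n%:Z) = 0 by apply: tors2n; rewrite e2 mul0rz.
apply/trivialP; rewrite pE; apply/(family_pair_trivial n_ge1 detA _ e2n enn).
split=> //; move/ker_modP: wE => [psi psiE]; exists (val psi); split=> // s.
by rewrite psiE !ffunE addrC.
Qed.
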